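(* Let $\mathbb{K}=\mathbb{F}_q$ be a finite field and let $X$ be a complete simplicial toric variety over $\mathbb{K}$ with torsion-free class group $\operatorname{Cl}(X)\cong\mathbb{Z}^d$, total coordinate ring $S=\mathbb{K}[x_1,\dots,x_r]$ and degree matrix $\beta$. Let $Q\in M_{s\times r}(\mathbb{Z})$ and let $Y_Q\subseteq T_X$ be the toric set parameterized by $Q$. Put $L_Q=\ker_{\mathbb{Z}}Q$, $L_\beta=\ker_{\mathbb{Z}}\beta$, $\mathcal{L}=QL_\beta=\{Q\mathbf{m} : \mathbf{m}\in L_\beta\}\subseteq\mathbb{Z}^s$, and $\mathcal{L}:(q-1)=\{\mathbf{m}\in\mathbb{Z}^s : (q-1)\mathbf{m}\in\mathcal{L}\}$. Let $L=(L_Q\cap L_\beta)+(q-1)L_\beta$. Then $I_L\subseteq I(Y_Q)$. Moreover, the equality $I_L=I(Y_Q)$ holds if and only if $\mathcal{L}=\mathcal{L}:(q-1)$.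
   Context: Setting. $X$ is given by a fan $\Sigma$ in $\mathbb{R}^n$ with $r$ rays, whose primitive generators $\mathbf{v}_1,\dots,\mathbf{v}_r\in\mathbb{Z}^n$ span $\mathbb{R}^n$; $d=r-n$. Let $\phi:\mathbb{Z}^n\to\mathbb{Z}^r$ be the linear map given by the $r\times n$ matrix with rows $\mathbf{v}_1,\dots,\mathbf{v}_r$, and let $\beta:\mathbb{Z}^r\to\mathbb{Z}^d$ be a linear map (identified with a $d\times r$ integer matrix with columns $\beta_j=\beta(e_j)$) such that $0\to\mathbb{Z}^n\xrightarrow{\phi}\mathbb{Z}^r\xrightarrow{\beta}\mathbb{Z}^d\to 0$ is exact (so $\operatorname{Cl}(X)\cong\mathbb{Z}^d$). The ring $S$ is $\mathbb{Z}^d$-graded by $\deg(x_j)=\beta_j$. For $\mathbf{a}\in\mathbb{Z}^k$ and $\mathbf{t}=(t_1,\dots,t_k)$ write $\mathbf{t}^{\mathbf{a}}=t_1^{a_1}\cdots t_k^{a_k}$. Let $\mathbf{u}_1,\dots,\mathbf{u}_n$ be the columns of $\phi$, let $\pi:(\mathbb{K}^* )^r\to(\mathbb{K}^* )^n$, $\pi(\mathbf{t})=(\mathbf{t}^{\mathbf{u}_1},\dots,\mathbf{t}^{\mathbf{u}_n})$, and $G=\ker\pi$. The torus of $X$ is $T_X=(\mathbb{K}^* )^r/G$, with elements $[p_1:\cdots:p_r]:=G\cdot(p_1,\dots,p_r)$. For $Q=[\mathbf{q}_1\cdots\mathbf{q}_r]\in M_{s\times r}(\mathbb{Z})$ (columns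 $\mathbf{q}_i\in\mathbb{Z}^s$), the toric set parameterized by $Q$ is $Y_Q=\{[\mathbf{t}^{\mathbf{q}_1}:\cdots:\mathbf{t}^{\mathbf{q}_r}] : \mathbf{t}\in(\mathbb{K}^* )^s\}\subseteq T_X$. The vanishing ideal $I(Y)\subseteq S$ of a set $Y$ of points of $X$ is the ideal generated by all homogeneous polynomials of $S$ (for the $\mathbb{Z}^d$-grading) that vanish at all points of $Y$. A lattice is a subgroup $L\subseteq\mathbb{Z}^r$; its lattice ideal $I_L\subseteq S$ is the ideal generated by all binomials $\mathbf{x}^{\mathbf{a}}-\mathbf{x}^{\mathbf{b}}$ with $\mathbf{a},\mathbf{b}\in\mathbb{N}^r$ and $\mathbf{a}-\mathbf{b}\in L$ (where $\mathbb{N}$ is the set of non-negative integers). For an integer matrix $M$ with $r$ columns, $\ker_{\mathbb{Z}}M=\{\mathbf{m}\in\mathbb{Z}^r : M\mathbf{m}=0\}$. *)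

(* Defs.v *)
From mathcomp Require Export all_boot all_order all_algebra.
From mathcomp Require Export mpoly.
From mathcomp Require Export boolp classical_sets cardinality reals.

Set Implicit Arguments.
Unset Strict Implicit.
Unset Printing Implicit Defensive.

Import Order.TTheory GRing.Theory Num.Theory.

Local Open Scope classical_set_scope.
Local Open Scope ring_scope.

(* Vectors of R^n are rows, elements of Z^k are columns. *)

Section Fans.
Variables (R : realType) (n : nat).
Implicit Types (sigma tau rho : set 'rV[R]_n) (Sigma : set (set 'rV[R]_n)).

Definition cone_gen k (A : 'M[R]_(k, n)) : set 'rV[R]_n :=
  [set c *m A | c in [set c : 'rV[R]_k | forall i, 0 <= c 0 i]].

Definition int_cone k (A : 'M[int]_(k, n)) : set 'rV[R]_n :=
  cone_gen (map_mx intr A).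

Definition rational_polyhedral sigma :=
  exists k, exists A : 'M[int]_(k, n), sigma = int_cone A.

Definition strongly_convex sigma := forall x, sigma x -> sigma (- x) -> x = 0.

(* u is the linear form cutting out a supporting hyperplane (u = 0 gives
   sigma itself). *)
Definition is_face tau sigma :=
  exists u : 'cV[R]_n, (forall x, sigma x -> 0 <= (x *m u) 0 0) /\
    tau = [set x | sigma x /\ (x *m u) 0 0 = 0].

Definition simplicial_cone sigma :=
  exists k, exists2 A : 'M[R]_(k, n), row_free A & sigma = cone_gen A.

(* The linear span of rho is a line. *)
Definition one_dimensional rho :=
  exists w, [/\ rho w, w != 0 & forall x, rho x -> exists c, x = c *: w].

Record is_fan Sigma : Prop := IsFan {
  fan_finite : finite_set Sigma;
  fan_rational : forall sigma, Sigma sigma -> rational_polyhedral sigma;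
  fan_convex : forall sigma, Sigma sigma -> strongly_convex sigma;
  fan_face : forall sigma tau, Sigma sigma -> is_face tau sigma -> Sigma tau;
  fan_cap : forall sigma tau, Sigma sigma -> Sigma tau ->
    is_face (sigma `&` tau) sigma /\ is_face (sigma `&` tau) tau
}.

Definition simplicial_fan Sigma :=
  forall sigma, Sigma sigma -> simplicial_cone sigma.

Definition complete_fan Sigma := forall x, exists2 sigma, Sigma sigma & sigma x.

Definition primitive (v : 'rV[int]_n) := \big[gcdn/0%N]_(j < n) absz (v 0 j) = 1%N.

(* The rows of phi are the distinct primitive generators v_1, ..., v_r of the
   rays, i.e. of the one-dimensional cones, of Sigma. *)
Record ray_matrix Sigma r (phi : 'M[int]_(r, n)) : Prop := RayMatrix {
  ray_primitive : forall i, primitive (row i phi);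
  ray_inj : injective (fun i => row i phi);
  ray_cones : forall rho, Sigma rho /\ one_dimensional rho <->
    exists i, rho = int_cone (row i phi)
}.

End Fans.

Definition kerZ k l (M : 'M[int]_(k, l)) : set 'cV[int]_l :=
  [set m | M *m m = 0].

Definition imZ k l (M : 'M[int]_(k, l)) (L : set 'cV[int]_l) :
    set 'cV[int]_k := [set M *m m | m in L].

Definition scaleL k (c : int) (L : set 'cV[int]_k) : set 'cV[int]_k :=
  [set c *: m | m in L].

Definition addL k (L1 L2 : set 'cV[int]_k) : set 'cV[int]_k :=
  [set m | exists a b, [/\ L1 a, L2 b & m = a + b]].

Definition colonL k (L : set 'cV[int]_k) (c : int) : set 'cV[int]_k :=
  [set m | L (c *: m)].

Record short_exact n r d (phi : 'M[int]_(r, n)) (beta : 'M[int]_(d, r)) :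
    Prop := ShortExact {
  exact_inj : injective (fun m : 'cV[int]_n => phi *m m);
  exact_mid : kerZ beta = range (fun m : 'cV[int]_n => phi *m m);
  exact_surj : forall y : 'cV[int]_d, exists m : 'cV[int]_r, beta *m m = y
}.

Section Torus.
Variable K : fieldType.

Definition torus k : set {ffun 'I_k -> K} := [set t | forall i, t i != 0].

Definition tpow k (t : {ffun 'I_k -> K}) (a : 'cV[int]_k) : K :=
  \prod_(i < k) t i ^ a i 0.

(* t |-> (t^{m_1}, ..., t^{m_l}), where the m_j are the columns of M *)
Definition tmap k l (M : 'M[int]_(k, l)) (t : {ffun 'I_k -> K}) :
    {ffun 'I_l -> K} := [ffun j => tpow t (col j M)].

Section ToricVariety.
Variables (n r : nat) (phi : 'M[int]_(r, n)).

(* G = ker pi, where pi = tmap phi *)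
Definition Ggroup : set {ffun 'I_r -> K} :=
  [set g | torus g /\ forall j, tmap phi g j = 1].

(* [p_1 : ... : p_r] = G . (p_1, ..., p_r) *)
Definition tpoint (p : {ffun 'I_r -> K}) : set {ffun 'I_r -> K} :=
  [set [ffun i => g i * p i] | g in Ggroup].

Definition TX : set (set {ffun 'I_r -> K}) := [set tpoint p | p in @torus r].

Definition toric_set s (Q : 'M[int]_(s, r)) : set (set {ffun 'I_r -> K}) :=
  [set tpoint (tmap Q t) | t in @torus s].

Lemma toric_set_sub s (Q : 'M[int]_(s, r)) : toric_set Q `<=` TX.
Proof.
move=> _ [t tT <-]; exists (tmap Q t) => // i; rewrite ffunE.
by apply/prodf_neq0 => j _; apply/expfz_neq0/tT.
Qed.

End ToricVariety.
End Torus.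
Arguments toric_set K {n r} phi {s} Q.

Section Ideals.
Variables (K : fieldType) (r : nat).
Local Notation S := {mpoly K[r]}.

Definition ideal_gen (A : set S) : set S :=
  [set f | exists k, exists g h : 'I_k -> S,
     (forall i, A (g i)) /\ f = \sum_(i < k) h i * g i].

Definition expvec (a : 'X_{1..r}) : 'cV[int]_r := \col_i (a i)%:Z.

Definition lattice_ideal (L : set 'cV[int]_r) : set S :=
  ideal_gen [set f | exists a b : 'X_{1..r},
    L (expvec a - expvec b) /\ f = 'X_[a] - 'X_[b]].

(* deg x_j is the j-th column of beta. *)
Definition mondeg d (beta : 'M[int]_(d, r)) (a : 'X_{1..r}) : 'cV[int]_d :=
  \sum_(j < r) (a j)%:Z *: col j beta.

Definition homogeneous d (beta : 'M[int]_(d, r)) (f : S) :=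
  exists alpha, forall a, a \in msupp f -> mondeg beta a = alpha.

(* Vanishing at a point G . p means vanishing at all its representatives; when
   ker beta = im phi, for a homogeneous f this does not depend on the
   representative. *)
Definition vanishes_at (f : S) (P : set {ffun 'I_r -> K}) :=
  forall p, P p -> f.@[p] = 0.

Definition vanishing_ideal d (beta : 'M[int]_(d, r))
    (Y : set (set {ffun 'I_r -> K})) : set S :=
  ideal_gen [set f | homogeneous beta f /\ forall P, Y P -> vanishes_at f P].

End Ideals.
Arguments lattice_ideal K {r} L.

(* Main.v *)
(** Let L' be the lattice of all m in L_beta with Q m in (q-1)Z^s.  A homogeneous
    f restricted to Y_Q is a linear combination of the characters t^(Qa) of
    (F_q^* )^s, and t^(Qa) = t^(Qb) exactly when Q(a - b) is in (q-1)Z^s; since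
    distinct characters are orthogonal, f vanishes on Y_Q iff its coefficients
    sum to 0 over each class of exponents modulo L'.  Hence I(Y_Q) = I_L'.  As a
    lattice is determined by its lattice ideal, I_L = I(Y_Q) amounts to L = L',
    which unwinds to QL_beta = QL_beta : (q-1). *)

Require Import Defs.
From mathcomp Require Import finfield ring.

Set Implicit Arguments.
Unset Strict Implicit.
Unset Printing Implicit Defensive.

Import Order.TTheory GRing.Theory Num.Theory.

Local Open Scope classical_set_scope.
Local Open Scope ring_scope.

(** * Closure properties of generated ideals *)

Section IdealGen.
Variables (K : fieldType) (r : nat).
Implicit Types (A B : set {mpoly K[r]}) (f g : {mpoly K[r]}).

Lemma ideal_genM A f g : ideal_gen A g -> ideal_gen A (f * g).
Proof.
move=> [k [u [v [Au ->]]]]; exists k, u, (fun i => f * v i); split=> //.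
by rewrite mulr_sumr; apply: eq_bigr => i _; rewrite mulrA.
Qed.

Lemma ideal_gen0 A : ideal_gen A 0.
Proof.
exists 0%N, (fun=> 0), (fun=> 0); split; first by case.
by rewrite big_ord0.
Qed.

Lemma ideal_genD A f g : ideal_gen A f -> ideal_gen A g -> ideal_gen A (f + g).
Proof.
move=> [k [u [v [Au ->]]]] [l [u' [v' [Au' ->]]]].
pose glue (w : 'I_k -> {mpoly K[r]}) w' (i : 'I_(k + l)) :=
  match split i with inl j => w j | inr j => w' j end.
have glueL w w' i : glue w w' (lshift l i) = w i.
  by rewrite /glue -[lshift l i]/(unsplit (inl i)) unsplitK.
have glueR w w' i : glue w w' (rshift k i) = w' i.
  by rewrite /glue -[rshift k i]/(unsplit (inr i)) unsplitK.
exists (k + l)%N, (glue u u'), (glue v v'); split.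
  by move=> i; rewrite /glue; case: split => j.
rewrite big_split_ord /=; congr (_ + _).
  by apply: eq_bigr => i _; rewrite !glueL.
by apply: eq_bigr => i _; rewrite !glueR.
Qed.

Lemma ideal_gen_sum A (I : eqType) (s : seq I) (F : I -> {mpoly K[r]}) :
  (forall i, i \in s -> ideal_gen A (F i)) -> ideal_gen A (\sum_(i <- s) F i).
Proof.
move=> AF; rewrite big_seq.
by apply: big_ind => //; [exact: ideal_gen0 | exact: ideal_genD].
Qed.

Lemma sub_ideal_gen A : A `<=` ideal_gen A.
Proof.
move=> f Af; exists 1%N, (fun=> f), (fun=> 1); split=> //.
by rewrite big_ord1 mul1r.
Qed.

Lemma ideal_gen_min A B : A `<=` ideal_gen B -> ideal_gen A `<=` ideal_gen B.
Proof.
move=> AB _ [k [u [v [Au ->]]]]; apply: ideal_gen_sum => i _.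
exact/ideal_genM/AB.
Qed.

End IdealGen.

(** * Weighted sums of coefficients as linear forms *)

Section SupportSum.
Variables (K : fieldType) (r : nat) (w : 'X_{1..r} -> K).

Definition supp_sum (f : {mpoly K[r]}) : K := \sum_(c <- msupp f) f@_c * w c.

(** Exponents outside the support contribute zero. This lets f, g and f + g be summed over one
    common list, although their supports differ. *)
Lemma supp_sum_widen (s : seq 'X_{1..r}) (f : {mpoly K[r]}) :
  uniq s -> {subset msupp f <= s} -> supp_sum f = \sum_(c <- s) f@_c * w c.
Proof.
move=> s_uniq fs; rewrite (bigID (mem (msupp f))) /= [X in _ + X]big1 ?addr0.
  rewrite -big_filter; apply: perm_big; apply: uniq_perm.
  - exact: msupp_uniq.
  - exact: filter_uniq.
  by move=> c; rewrite mem_filter; case: (boolP (c \in msupp f)) => // /fs ->.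
by move=> c /memN_msupp_eq0 ->; rewrite mul0r.
Qed.

Lemma supp_sumD : {morph supp_sum : f g / f + g}.
Proof.
move=> f g; pose s := undup (msupp f ++ msupp g).
have us : uniq s by exact: undup_uniq.
rewrite !(@supp_sum_widen s) //.
- by rewrite -big_split; apply: eq_bigr => c _; rewrite mcoeffD mulrDl.
- by move=> c cg; rewrite mem_undup mem_cat cg orbT.
- by move=> c cf; rewrite mem_undup mem_cat cf.
- by move=> c /msuppD_le; rewrite mem_undup.
Qed.

Lemma supp_sumZX c a : supp_sum (c *: 'X_[a]) = c * w a.
Proof.
rewrite (@supp_sum_widen [:: a]) //.
  by rewrite big_seq1 mcoeffZ mcoeffX eqxx mulr1.
by move=> b /msuppZ_le; rewrite msuppX.
Qed.

Lemma supp_sum0 : supp_sum 0 = 0.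
Proof. by rewrite /supp_sum -mpolyC0 msupp0 big_nil. Qed.

End SupportSum.

(** * A lattice is determined by its lattice ideal *)

Section LatticeIdeal.
Variables (K : fieldType) (r : nat).
Implicit Types (L : set 'cV[int]_r).

Definition subgroup_set k (L : set 'cV[int]_k) :=
  L 0 /\ forall u v, L u -> L v -> L (u - v).

Lemma lattice_idealS L1 L2 :
  L1 `<=` L2 -> lattice_ideal K L1 `<=` lattice_ideal K L2.
Proof.
move=> L12; apply: ideal_gen_min => _ [a [b [Lab ->]]].
by apply: sub_ideal_gen; exists a, b; split=> //; exact: L12.
Qed.

Lemma expvecD (a b : 'X_{1..r}) : expvec (a + b)%MM = expvec a + expvec b.
Proof. by apply/colP => i; rewrite !mxE mnmDE PoszD. Qed.

(* The sum of the coefficients over one coset of L is a linear form killing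
   I_L. *)
Lemma lattice_ideal_binomial L (a b : 'X_{1..r}) : subgroup_set L ->
  lattice_ideal K L ('X_[a] - 'X_[b]) -> L (expvec a - expvec b).
Proof.
move=> [L0 LB] [k [g [h [gL fE]]]].
have LN u : L u -> L (- u) by move=> Lu; rewrite -sub0r; exact: LB.
have LD u v : L u -> L v -> L (u + v).
  by move=> Lu Lv; rewrite -[v]opprK; exact/LB/LN.
pose w (c : 'X_{1..r}) : K := `[< L (expvec c - expvec b) >]%:R.
have binE (e : K) u v :
    supp_sum w (e *: ('X_[u] - 'X_[v])) = e * (w u - w v).
  by rewrite scalerBr -scaleNr supp_sumD !supp_sumZX mulNr mulrBr.
have : supp_sum w ('X_[a] - 'X_[b]) = 0.
  rewrite fE (big_morph _ (@supp_sumD _ _ w) (@supp_sum0 _ _ w)).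
  apply: big1 => i _; have [u [v [Luv ->]]] := gL i.
  rewrite [h i]mpolyE mulr_suml.
  rewrite (big_morph _ (@supp_sumD _ _ w) (@supp_sum0 _ _ w)).
  apply: big1 => c _; rewrite -scalerAl mulrBr -!mpolyXD binE.
  suff -> : w (c + u)%MM = w (c + v)%MM by rewrite subrr mulr0.
  rewrite /w !expvecD; congr (_%:R); congr (nat_of_bool _).
  apply/asbool_equiv_eq; split=> Lc.
    have -> : expvec c + expvec v - expvec b =
      (expvec c + expvec u - expvec b) - (expvec u - expvec v).
      by apply/colP => j; rewrite !mxE; ring.
    exact: LB.
  have -> : expvec c + expvec u - expvec b =
    (expvec c + expvec v - expvec b) + (expvec u - expvec v).
    by apply/colP => j; rewrite !mxE; ring.
  exact: LD.
(* On x^a - x^b the form takes the value [w a - 1], so its vanishing rules out [w a = 0]. *)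
rewrite -['X_[a] - _]scale1r binE mul1r /w subrr (asboolT L0).
case: asboolP => // _ /eqP.
by rewrite sub0r oppr_eq0 oner_eq0.
Qed.

(** Every m in Z^r is the difference of its positive and negative parts, so whether m lies in L can
    be read off from one binomial of I_L. *)
Lemma lattice_ideal_inj L1 L2 : subgroup_set L1 -> subgroup_set L2 ->
  lattice_ideal K L1 = lattice_ideal K L2 -> L1 = L2.
Proof.
suff sub L L' : subgroup_set L' ->
    lattice_ideal K L = lattice_ideal K L' -> L `<=` L'.
  by move=> sL1 sL2 eqI; apply/seteqP; split; apply: sub.
move=> sL' eqI m Lm.
pose a : 'X_{1..r} :=
  [multinom (if 0 <= m i 0 then absz (m i 0) else 0%N)%R | i < r].
pose b : 'X_{1..r} :=
  [multinom (if 0 <= m i 0 then 0%N else absz (m i 0))%R | i < r].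
have mE : m = expvec a - expvec b.
  apply/colP => i; rewrite !mxE !mnmE; case: ifPn => [m_ge0|].
    by rewrite gez0_abs // subr0.
  by rewrite -ltNge => m_lt0; rewrite ltz0_abs // sub0r opprK.
rewrite mE; apply: lattice_ideal_binomial => //.
by rewrite -eqI; apply: sub_ideal_gen; exists a, b; rewrite -mE.
Qed.

End LatticeIdeal.

(** * Characters of tori and monomial maps *)

Section TorusPowers.
Variable K : fieldType.

Lemma tpowD k (t : {ffun 'I_k -> K}) (u v : 'cV[int]_k) :
  torus t -> tpow t (u + v) = tpow t u * tpow t v.
Proof.
move=> tT; rewrite /tpow -big_split; apply: eq_bigr => i _.
by rewrite mxE expfzDr.
Qed.

Lemma tpow0 k (t : {ffun 'I_k -> K}) : tpow t 0 = 1.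
Proof. by apply: big1 => i _; rewrite mxE expr0z. Qed.

Lemma tpowM k (t t' : {ffun 'I_k -> K}) (u : 'cV[int]_k) :
  tpow [ffun i => t i * t' i] u = tpow t u * tpow t' u.
Proof.
by rewrite /tpow -big_split; apply: eq_bigr => i _; rewrite ffunE expfzMl.
Qed.

Lemma tpow_tmap k l (M : 'M[int]_(k, l)) (t : {ffun 'I_k -> K})
    (u : 'cV[int]_l) : torus t -> tpow (tmap M t) u = tpow t (M *m u).
Proof.
move=> tT; rewrite /tpow.
under eq_bigr => j _.
  rewrite ffunE /tpow (big_morph (fun x : K => x ^ u j 0)
    (fun x y => expfzMl x y _) (exp1rz _ _)).
  over.
rewrite exchange_big; apply: eq_bigr => i _.
rewrite mxE (big_morph (fun a : int => t i ^ a)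
  (fun a b => expfzDr a b (tT i)) (expr0z _)).
by apply: eq_bigr => j _; rewrite mxE exprz_exp.
Qed.

Lemma torus_tmap k l (M : 'M[int]_(k, l)) (t : {ffun 'I_k -> K}) :
  torus t -> torus (tmap M t).
Proof.
by move=> tT i; rewrite ffunE; apply/prodf_neq0 => j _; apply/expfz_neq0/tT.
Qed.

(** Exactness gives m = phi c, hence g^m = pi(g)^c = 1. Thus binomials homogeneous for beta do not
    distinguish the points of a G-orbit. *)
Lemma tpow_Ggroup n r d (phi : 'M[int]_(r, n)) (beta : 'M[int]_(d, r)) g m :
  short_exact phi beta -> @Ggroup K n r phi g -> kerZ beta m -> tpow g m = 1.
Proof.
move=> [_ mid _] [gT g1]; rewrite mid => -[c _ <-].
rewrite -tpow_tmap //; apply: big1 => j _.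
by rewrite g1 exp1rz.
Qed.

Lemma Ggroup1 n r (phi : 'M[int]_(r, n)) :
  @Ggroup K n r phi [ffun=> 1].
Proof.
split=> [i | j]; first by rewrite ffunE oner_neq0.
by rewrite ffunE; apply: big1 => i _; rewrite ffunE exp1rz.
Qed.

Lemma mevalX_tpow r (p : {ffun 'I_r -> K}) (a : 'X_{1..r}) :
  ('X_[a] : {mpoly K[r]}).@[p] = tpow p (expvec a).
Proof. by rewrite mevalX; apply: eq_bigr => i _; rewrite mxE. Qed.

End TorusPowers.

Lemma mondegE r d (beta : 'M[int]_(d, r)) (a : 'X_{1..r}) :
  mondeg beta a = beta *m expvec a.
Proof.
apply/colP => i; rewrite /mondeg summxE !mxE; apply: eq_bigr => j _.
by rewrite !mxE mulrC.
Qed.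

(** * Congruence of integer vectors modulo c *)

Section DivisibleVectors.
Variables (c : int) (k : nat).
Implicit Types (u v : 'cV[int]_k).

(** Boolean, so that it can filter finite sums and drive [find]. *)
Definition dvdcv u := [forall i, (c %| u i 0%R)%Z].

Lemma dvdcvP u : reflect (exists z, u = c *: z) (dvdcv u).
Proof.
apply: (iffP forallP) => [cu | [z -> i]]; last by rewrite mxE dvdz_mulr.
exists (\col_i (u i 0%R %/ c)%Z); apply/colP => i; rewrite !mxE mulrC.
by rewrite divzK.
Qed.

Lemma dvdcv0 : dvdcv 0.
Proof. by apply/forallP => i; rewrite mxE dvdz0. Qed.

Lemma dvdcvB u v : dvdcv u -> dvdcv v -> dvdcv (u - v).
Proof.
move=> /dvdcvP[x ->] /dvdcvP[y ->]; apply/dvdcvP.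
by exists (x - y); rewrite scalerBr.
Qed.

Lemma dvdcvBC u v : dvdcv (u - v) = dvdcv (v - u).
Proof.
by apply/idP/idP => uv; rewrite -opprB -sub0r dvdcvB ?dvdcv0.
Qed.

Lemma dvdcvB_trans u v w : dvdcv (u - v) -> dvdcv (v - w) -> dvdcv (u - w).
Proof.
move=> uv; rewrite dvdcvBC => wv.
rewrite (_ : u - w = (u - v) - (w - v)); first exact: dvdcvB.
by rewrite opprB addrA subrK.
Qed.

End DivisibleVectors.

(** * Character sums over a finite field and the vanishing ideal of a toric set *)

Section FiniteField.
Variable K : finFieldType.
Local Notation q1 := (#|K|%:Z - 1).

(** Translation by 1 permutes K, so adding 1 to every element leaves the sum of all elements
    unchanged. *)
Lemma natr_card_finField : #|K|%:R = 0 :> K.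
Proof.
have /eqP : \sum_(x : K) (x + 1) = \sum_(x : K) x.
  by rewrite [RHS](reindex_inj (addIr 1)).
by rewrite big_split /= sumr_const addrC -subr_eq0 addrK => /eqP.
Qed.

Lemma q1E : q1 = (#|K|.-1)%:Z.
Proof.
rewrite -[#|K| in LHS](prednK (ltnW (finNzRing_gt1 K))).
by rewrite -addn1 PoszD addrK.
Qed.

Lemma q1_neq0 : q1 != 0.
Proof. by rewrite q1E; move: (finNzRing_gt1 K); case: #|K| => [|[]]. Qed.

Lemma expf_q1 (x : K) : x != 0 -> x ^ q1 = 1.
Proof.
by move=> x0; rewrite expfzDr // exprN1 -exprnP expf_card divff.
Qed.

(** Otherwise all q - 1 units would be roots of X^e - 1, where e = k mod (q - 1) satisfies 0 < e < q
    - 1. *)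
Lemma exists_expz_neq1 (k : int) :
  ~~ (q1 %| k)%Z -> exists2 x : K, x != 0 & x ^ k != 1.
Proof.
move=> q1k; apply: contrapT => no.
have all1 (x : K) : x != 0 -> x ^ k = 1.
  by move=> x0; apply: contrapT => xk; apply: no; exists x => //; exact/eqP.
have mod_ge0 := modz_ge0 k q1_neq0.
have [e eE] : exists e : nat, (k %% q1)%Z = e.
  by exists (absz (k %% q1)%Z); rewrite gez0_abs.
have e_gt0 : (0 < e)%N.
  rewrite lt0n; apply: contra q1k => /eqP e0.
  by apply/dvdz_mod0P; rewrite eE e0.
have e_lt : (e < #|K|.-1)%N.
  rewrite -ltz_nat -eE -q1E ltz_pmod // q1E ltz_nat.
  by rewrite -ltnS prednK ?finNzRing_gt1 // ltnW ?finNzRing_gt1.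
have := @max_unity_roots K e (enum (predC1 (0 : K))) e_gt0.
rewrite -cardE cardC1 enum_uniq leqNgt e_lt => H.
suff /H : all e.-unity_root (enum (predC1 (0 : K))) by move=> /(_ isT).
apply/allP => x; rewrite mem_enum inE => x0; apply/unity_rootP.
rewrite -(all1 x x0) exprnP -eE [in RHS](divz_eq k q1).
by rewrite (expfzDr (_ * _)) // (mulrC _ q1) -exprz_exp expf_q1 // exp1rz mul1r.
Qed.

(** If q - 1 divides k, all q - 1 terms are 1, and q - 1 = -1 in K. Otherwise the substitution x ->
    y x multiplies the sum by some y^k != 1, which forces it to be 0. *)
Lemma sum_expz (k : int) :
  \sum_(x : K | x != 0) x ^ k = if (q1 %| k)%Z then -1 else 0.
Proof.
case: ifPn => [/dvdzP[z ->] | /exists_expz_neq1[y y0 yk]].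
  rewrite (eq_bigr (fun=> 1)); last first.
    by move=> x x0; rewrite mulrC -exprz_exp expf_q1 // exp1rz.
  apply/eqP; rewrite sumr_const cardC1 -addr_eq0 -mulrSr.
  by rewrite prednK ?natr_card_finField // ltnW ?finNzRing_gt1.
have : \sum_(x : K | x != 0) x ^ k = y ^ k * \sum_(x : K | x != 0) x ^ k.
  rewrite mulr_sumr [LHS](reindex_inj (mulfI y0)).
  apply: eq_big => [x | x _]; first by rewrite mulf_eq0 negb_or y0.
  by rewrite expfzMl.
move=> /eqP; rewrite -subr_eq0 -{1}[X in X - _]mul1r -mulrBl mulf_eq0.
by rewrite subr_eq0 eq_sym (negPf yk) => /eqP.
Qed.

(** The sum over the torus factors into s one-variable sums. *)
Lemma sum_tpow s (u : 'cV[int]_s) :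
  \sum_(t in ffun_on (predC1 (0 : K))) tpow t u =
    if dvdcv q1 u then (-1) ^+ s else 0.
Proof.
rewrite -(bigA_distr_big (predC1 (0 : K)) (fun i x => x ^ u i 0)) /=.
under eq_bigr => i _ do rewrite sum_expz.
case: ifPn => [/forallP qu | /forallPn[i qi]].
  under eq_bigr => i _ do rewrite qu.
  by rewrite prodr_const card_ord.
by rewrite (bigD1 i) //= (negPf qi) mul0r.
Qed.

Lemma ffun_on_torus s (t : {ffun 'I_s -> K}) :
  t \in ffun_on (predC1 (0 : K)) -> torus t.
Proof. by move=> /ffun_onP tT i; have := tT i; rewrite inE. Qed.

(* Multiply f(t^Q) by t^(-Qa) and sum over the torus: only the monomials in the
   class of a survive, each with the factor (q-1)^s = (-1)^s. *)
Lemma class_sum_eq0 r s (Q : 'M[int]_(s, r)) (f : {mpoly K[r]}) :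
  (forall t, torus t -> f.@[tmap Q t] = 0) ->
  forall a,
    \sum_(b <- msupp f | dvdcv q1 (Q *m (expvec b - expvec a))) f@_b = 0.
Proof.
move=> f0 a.
have : \sum_(t in ffun_on (predC1 (0 : K)))
    tpow t (- (Q *m expvec a)) * f.@[tmap Q t] = 0.
  by apply: big1 => t /ffun_on_torus /f0 ->; rewrite mulr0.
rewrite (eq_bigr (fun t => \sum_(b <- msupp f)
  f@_b * tpow t (Q *m (expvec b - expvec a)))); last first.
  move=> t /ffun_on_torus tT; rewrite {1}[f]mpolyE raddf_sum mulr_sumr /=.
  apply: eq_bigr => b _; rewrite mevalZ mevalX_tpow tpow_tmap // mulrCA.
  by rewrite -tpowD // mulmxBr addrC.
rewrite exchange_big /=.
under eq_bigr => b _ do rewrite -mulr_sumr sum_tpow.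
(* The sign (-1)^s is its own inverse, so a second factor clears it. *)
move=> /(congr1 ( *%R ((-1) ^+ s))); rewrite mulr0 => sum0.
rewrite -[RHS]sum0 mulr_sumr big_mkcond; apply: eq_bigr => b _.
case: ifP => _; last by rewrite !mulr0.
by rewrite mulrCA -expr2 sqrr_sign mulr1.
Qed.

(** The lattice L'. The first condition makes the binomials homogeneous; the second makes the
    character t^(Qm) trivial on the torus. *)
Definition toric_lattice d r s (beta : 'M[int]_(d, r)) (Q : 'M[int]_(s, r)) :
    set 'cV[int]_r :=
  [set m | kerZ beta m /\ dvdcv q1 (Q *m m)].

Lemma tpow_dvdcv s (t : {ffun 'I_s -> K}) u :
  torus t -> dvdcv q1 u -> tpow t u = 1.
Proof.
move=> tT /dvdcvP[z ->]; apply: big1 => i _.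
by rewrite mxE -exprz_exp expf_q1 // exp1rz.
Qed.

Lemma vanishing_ideal_toric_set n r d s (phi : 'M[int]_(r, n))
    (beta : 'M[int]_(d, r)) (Q : 'M[int]_(s, r)) :
  short_exact phi beta ->
  vanishing_ideal beta (toric_set K phi Q) =
  lattice_ideal K (toric_lattice beta Q).
Proof.
move=> ex; apply/seteqP; split; apply: ideal_gen_min => f.
  move=> [[alpha fh] fv].
  have f0 t : torus t -> f.@[tmap Q t] = 0.
    move=> tT; apply: (fv (tpoint phi (tmap Q t))); first by exists t.
    exists [ffun=> 1]; first exact: Ggroup1.
    by apply/ffunP => i; rewrite !ffunE mul1r.
  have cs := class_sum_eq0 f0.
  pose e (b c : 'X_{1..r}) := dvdcv q1 (Q *m expvec b - Q *m expvec c).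
  have exx b : e b b by rewrite /e subrr dvdcv0.
  have esym b c : e b c = e c b by exact: dvdcvBC.
  have etrans b c c' : e b c -> e c c' -> e b c' by exact: dvdcvB_trans.
  (* The first exponent of the support equivalent to b. For b in the support the default [0%MM] is
     never reached, since b itself qualifies. *)
  pose rep b := nth 0%MM (msupp f) (find (e b) (msupp f)).
  have has_e b : b \in msupp f -> has (e b) (msupp f).
    by move=> bf; apply/hasP; exists b.
  have rep_e b : b \in msupp f -> e b (rep b).
    by move=> /has_e; exact: nth_find.
  have rep_in b : b \in msupp f -> rep b \in msupp f.
    by move=> /has_e; rewrite has_find; exact: mem_nth.
  have rep_eq b c : b \in msupp f -> c \in msupp f -> (rep b == rep c) = e b c.
    move=> bf cf; apply/eqP/idP => [rbc | ebc].
      by apply: (etrans _ (rep b)); [exact: rep_e | rewrite rbc esym rep_e].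
    (* Equivalent exponents define the same predicate, hence the same first hit. *)
    rewrite /rep; congr nth; apply: eq_find => c'.
    apply/idP/idP; first by apply: etrans; rewrite esym.
    exact: etrans.
  (* The coefficient at a representative is the sum of f over its class, which is 0; at any other m
     no term contributes. *)
  have repsum0 : \sum_(b <- msupp f) f@_b *: 'X_[rep b] = 0 :> {mpoly K[r]}.
    apply/mpolyP => m; rewrite mcoeff0 raddf_sum /=.
    under eq_bigr => b _ do rewrite mcoeffZ mcoeffX.
    have [/hasP[b0 b0f /eqP <-] | /hasPn no] :=
        boolP (has (fun b => rep b == m) (msupp f)).
      rewrite -[RHS](cs b0) [RHS]big_mkcond big_seq [RHS]big_seq.
      apply: eq_bigr => b bf; rewrite rep_eq // mulmxBr -/(e b b0).
      by case: (e b b0); rewrite ?mulr1 ?mulr0.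
    by rewrite big_seq big1 // => b /no /negPf ->; rewrite mulr0.
  (* Subtracting this zero writes f as the sum of the f_b (x^b - x^(rep b)), whose binomials are
     generators of I_L'. *)
  rewrite -[f]subr0 -repsum0 {1}[f]mpolyE -sumrB.
  apply: ideal_gen_sum => b bf; rewrite -scalerBr -mul_mpolyC.
  apply/ideal_genM/sub_ideal_gen; exists b, (rep b); split=> //; split.
    by rewrite /kerZ /= mulmxBr -!mondegE !fh ?subrr // rep_in.
  by rewrite mulmxBr; exact: rep_e.
move=> [a [b [[Lab qab] ->]]]; apply: sub_ideal_gen; split.
  exists (mondeg beta a) => c /msuppB_le; rewrite !msuppX !inE.
  move=> /orP[/eqP -> // | /eqP ->]; apply/eqP; rewrite eq_sym -subr_eq0.
  by rewrite !mondegE -mulmxBr; apply/eqP.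
move=> _ [t tT <-] _ [g Gg <-]; have tQT := torus_tmap Q tT.
(* Since p^a = p^(a-b) p^b, it suffices that p^(a-b) = 1; here it is the product of g^(a-b) and
   t^(Q(a-b)), both equal to 1. *)
rewrite mevalB !mevalX_tpow -(subrK (expvec b) (expvec a)) tpowD; last first.
  by move=> i; rewrite ffunE mulf_neq0 //; case: Gg.
rewrite tpowM (tpow_Ggroup ex Gg Lab) mul1r tpow_tmap // tpow_dvdcv //.
by rewrite mul1r subrr.
Qed.

End FiniteField.

(** * Comparison of L with L' *)

Theorem theorem3p2 (K : finFieldType) (R : realType) (n r d s : nat)
    (Sigma : set (set 'rV[R]_n)) (phi : 'M[int]_(r, n)) (beta : 'M[int]_(d, r))
    (Q : 'M[int]_(s, r)) :
  is_fan Sigma -> complete_fan Sigma -> simplicial_fan Sigma ->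
  ray_matrix Sigma phi -> short_exact phi beta ->
  let q := #|K|%:Z in
  let LQ := kerZ Q in
  let Lbeta := kerZ beta in
  let QLbeta := imZ Q Lbeta in
  let L := addL (LQ `&` Lbeta) (scaleL (q - 1) Lbeta) in
  let YQ := toric_set K phi Q in
  lattice_ideal K L `<=` vanishing_ideal beta YQ /\
  (lattice_ideal K L = vanishing_ideal beta YQ <->
     QLbeta = colonL QLbeta (q - 1)).
Proof.
move=> _ _ _ _ ex q LQ Lbeta QLbeta L YQ.
rewrite (vanishing_ideal_toric_set K Q ex).
have LbetaB u v : Lbeta u -> Lbeta v -> Lbeta (u - v).
  by rewrite /Lbeta /kerZ /= mulmxBr => -> ->; rewrite subrr.
have LbetaZ (c : int) u : Lbeta u -> Lbeta (c *: u).
  by rewrite /Lbeta /kerZ /= -scalemxAr => ->; rewrite scaler0.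
have Lbeta0 : Lbeta 0 by exact: mulmx0.
have L_sub : L `<=` toric_lattice K beta Q.
  move=> _ [u [w [[Qu bu] [v bv <-] ->]]]; split.
    by rewrite -[_ *: v]opprK -scaleNr; apply: LbetaB => //; exact: LbetaZ.
  by rewrite mulmxDr Qu add0r -scalemxAr; apply/dvdcvP; exists (Q *m v).
split; first exact: lattice_idealS.
have sgL : subgroup_set L.
  split.
    exists 0, 0; split; rewrite ?addr0 //; first by split=> //; exact: mulmx0.
    by exists 0; rewrite ?scaler0.
  move=> _ _ [u [w [[Qu bu] [v bv <-] ->]]] [u' [w' [[Qu' bu'] [v' bv' <-] ->]]].
  exists (u - u'), ((q - 1) *: (v - v')); split.
  - by split; [rewrite /LQ /kerZ /= mulmxBr Qu Qu' subrr | exact: LbetaB].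
  - by exists (v - v') => //; exact: LbetaB.
  - by rewrite scalerBr opprD addrACA.
have sgL' : subgroup_set (toric_lattice K beta Q).
  split; first by split=> //; rewrite mulmx0 dvdcv0.
  move=> u v [bu qu] [bv qv]; split; first exact: LbetaB.
  by rewrite mulmxBr dvdcvB.
split=> [/(lattice_ideal_inj sgL sgL') LE | QE].
  apply/seteqP; split=> z.
    move=> [m bm <-]; exists ((q - 1) *: m); first exact: LbetaZ.
    by rewrite -scalemxAr.
  (* Here Qm = (q - 1) z puts m in L' = L. Writing m = u + (q - 1) v with Qu = 0 and cancelling q -
     1 gives z = Qv. *)
  move=> [m bm mz].
  have : L m by rewrite LE; split=> //; apply/dvdcvP; exists z.
  move=> [u [w [[Qu bu] [v bv <-] mE]]]; exists v => //.
  have /colP qz : (q - 1) *: (Q *m v) = (q - 1) *: z.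
    by rewrite -mz mE mulmxDr Qu add0r -scalemxAr.
  apply/colP => i; apply: (mulfI (q1_neq0 K)).
  by have := qz i; rewrite [LHS]mxE [RHS]mxE.
congr lattice_ideal; apply/seteqP; split=> // m [bm /dvdcvP[z mz]].
have : colonL QLbeta (q - 1) z by exists m.
rewrite -QE => -[v bv vz].
(* With Qm = (q - 1) z and z = Qv, removing (q - 1) v from m leaves an element of the kernel of
   Q. *)
exists (m - (q - 1) *: v), ((q - 1) *: v); split.
- split; last by apply: LbetaB => //; exact: LbetaZ.
  by rewrite /LQ /kerZ /= mulmxBr -scalemxAr vz mz subrr.
- by exists v.
- by rewrite subrK.
Qed.
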